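(* Let $\beta\in(0,1]$ and let $H^2(\beta)$ be the weighted Hardy space with weights $\beta_n^2=(1/\beta)^n$. Let $C_\phi\in B(H^2(\beta))$ be the composition operator with symbol $\phi(w)=\eta w$, $w\in\mathbb{D}$, where $\eta\in\overline{\mathbb{D}}$. Then the Berezin range $\mathrm{Ber}(C_\phi)$ is convex if and only if $\eta\in[-1,1]$.
   Context: $\mathbb D$ is the open unit disc in $\mathbb{C}$. For $\beta\in(0,1]$ and $\beta_n^2=(1/\beta)^n$, $H^2(\beta)$ is the Hilbert space of $f(z)=\sum_{n\ge0}a_nz^n$ with $\sum_n|a_n|^2\beta_n^2<\infty$ and inner product $\langle f,g\rangle=\sum_n a_n\overline{b_n}\beta_n^2$ (where $g(z)=\sum_n b_nz^n$), viewed as a reproducing kernel Hilbert space of analytic functions on $\mathbb D$ with reproducing kernel $k_w(z)=\frac{1}{1-\beta\overline{w}z}$, $w,z\in\mathbb D$. $B(H^2(\beta))$ is the set of bounded linear operators on it, and $C_\phi f=f\circ\phi$. With $\hat k_w=k_w/\|k_w\|$, the Berezin transform of a bounded operator $A$ is $\widetilde A(w)=\langle A\hat k_w,\hat k_w\rangle$ and its Berezin range is $\mathrm{Ber}(A)=\{\widetilde A(w):w\in\mathbb D\}\subset\mathbb C$. *)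

(* Defs.v *)
From Stdlib Require Import Reals ClassicalEpsilon.
From Coquelicot Require Import Coquelicot.

Open Scope R_scope.
Open Scope C_scope.

Definition unit_disc : Type := {z : C | (Cmod z < 1)%R}.
Definition disc_val (z : unit_disc) : C := proj1_sig z.
Coercion disc_val : unit_disc >-> C.

(* Unspecified when the series diverges. *)
Definition CSeries (a : nat -> C) : C :=
  iota (T := C_CompleteNormedModule)
    (@is_series C_AbsRing C_NormedModule a).

Definition is_expansion (a : nat -> C) (f : unit_disc -> C) : Prop :=
  forall z : unit_disc,
    @is_series C_AbsRing C_NormedModule (fun n => a n * Cpow z n) (f z).

(* Meaningful when [f] has a power series expansion on the disc; it is then
   unique, so the choice made by [epsilon] is immaterial. *)
Definition coef (f : unit_disc -> C) : nat -> C :=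
  epsilon (inhabits (fun _ => RtoC 0)) (fun a => is_expansion a f).

(* This is beta_n^2, not beta_n. *)
Definition weight (beta : R) (n : nat) : R := ((1 / beta) ^ n)%R.

Definition H2 (beta : R) (f : unit_disc -> C) : Prop :=
  exists a : nat -> C,
    is_expansion a f /\ ex_series (fun n => (Cmod (a n) ^ 2 * weight beta n)%R).

Definition H2_inner (beta : R) (f g : unit_disc -> C) : C :=
  CSeries (fun n => coef f n * Cconj (coef g n) * RtoC (weight beta n)).

Definition H2_norm (beta : R) (f : unit_disc -> C) : R :=
  sqrt (Re (H2_inner beta f f)).

Record bounded_operator (beta : R) (A : (unit_disc -> C) -> (unit_disc -> C)) : Prop := {
  bounded_operator_H2 : forall f, H2 beta f -> H2 beta (A f);
  bounded_operator_plus : forall f g, H2 beta f -> H2 beta g ->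
    A (fun z => f z + g z) = (fun z => A f z + A g z);
  bounded_operator_scal : forall (c : C) f, H2 beta f ->
    A (fun z => c * f z) = (fun z => c * A f z);
  bounded_operator_bound : exists M : R, forall f, H2 beta f ->
    (H2_norm beta (A f) <= M * H2_norm beta f)%R
}.

Definition composition_operator (phi : unit_disc -> unit_disc) (f : unit_disc -> C) :
  unit_disc -> C := fun z => f (phi z).

Definition kernel (beta : R) (w : unit_disc) : unit_disc -> C :=
  fun z => 1 / (1 - RtoC beta * Cconj w * z).

Definition normalized_kernel (beta : R) (w : unit_disc) : unit_disc -> C :=
  fun z => kernel beta w z / RtoC (H2_norm beta (kernel beta w)).

Definition berezin_transform (beta : R) (A : (unit_disc -> C) -> (unit_disc -> C))
    (w : unit_disc) : C :=
  H2_inner beta (A (normalized_kernel beta w)) (normalized_kernel beta w).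

Definition berezin_range (beta : R) (A : (unit_disc -> C) -> (unit_disc -> C)) :
  C -> Prop := fun c => exists w : unit_disc, berezin_transform beta A w = c.

Definition convex_set (S : C -> Prop) : Prop :=
  forall (x y : C) (t : R), S x -> S y -> (0 <= t <= 1)%R ->
    S (RtoC (1 - t) * x + RtoC t * y).

(* Main.v *)
Require Import Defs.
From Stdlib Require Import Reals.
From Coquelicot Require Import Coquelicot.
From Stdlib Require Import Lra ClassicalEpsilon.

(** The kernel at [w] has Taylor coefficients [(beta * conj w)^n], and composing
    it with [z |-> eta * z] multiplies them by [eta^n]; so every inner product
    that enters the Berezin transform is a geometric series
    ([H2_inner_simple_poles]), and with [s = beta * |w|^2] the transform equals
    [(1 - s) / (1 - eta * s)] ([berezin_transform_dilation]).  Only [|w|]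
    matters, and [s] sweeps out [[0, beta)] as [w] sweeps out the disc: the
    Berezin range is the image of [[0, beta)] under this linear fractional map
    ([berezin_range_dilation]).

    If [eta = t] is real and [t < 1], the map is a real-valued involution, so a
    number [y] is in the range when [(1 - y) / (1 - t * y)] is in [[0, beta)].
    That amounts to two affine inequalities in [y] ([real_range_iff]), whence
    convexity; for [t = 1] the range is the single point 1.

    If [eta] is not real, the image of a line segment under the map lies on a
    genuine circle and contains no segment.  Concretely, the midpoint of the
    values at [0] and at [s > 0] is a value at some [s'] only if
    [s - 2 * s' = - eta * s * s'] ([linear_fractional_value_midpoint]).  The
    imaginary part of this equation forces [s' = 0], and then its real part
    gives [s = 0], a contradiction. *)

Local Open Scope C_scope.

(** * Complex geometric series *)

Lemma sum_n_Cpow (q : C) (n : nat) : 1 - q <> 0 ->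
  sum_n (G := C_AbelianMonoid) (Cpow q) n = (1 - Cpow q (S n)) / (1 - q).
Proof.
  intros hq. induction n as [|n IH].
  - rewrite sum_O; simpl. field; exact hq.
  - rewrite sum_Sn, IH. simpl Cpow.
    change ((1 - q * Cpow q n) / (1 - q) + q * Cpow q n
            = (1 - q * (q * Cpow q n)) / (1 - q)).
    field; exact hq.
Qed.

Lemma RtoC_neq_0 (x : R) : x <> 0%R -> RtoC x <> 0.
Proof. intros hx h; apply hx; now apply RtoC_inj. Qed.

Lemma one_minus_neq_0 (q : C) : (Cmod q < 1)%R -> 1 - q <> 0.
Proof.
  intros hq h.
  assert (h1 : q = 1).
  { replace q with (1 - (1 - q)) by ring. rewrite h; ring. }
  rewrite h1, Cmod_1 in hq; lra.
Qed.

Lemma is_series_C_geometric (q : C) : (Cmod q < 1)%R ->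
  @is_series C_AbsRing C_NormedModule (Cpow q) (1 / (1 - q)).
Proof.
  intros hq. pose proof (one_minus_neq_0 q hq) as hq1.
  apply (filterlim_locally_ball_norm (U := C_NormedModule)).
  intros eps.
  assert (hpos : (0 < eps * Cmod (1 - q))%R).
  { apply Rmult_lt_0_compat; [apply cond_pos | now apply Cmod_gt_0]. }
  assert (hlim : is_lim_seq (fun n => (Cmod q ^ n)%R) 0).
  { apply is_lim_seq_geom; rewrite Rabs_pos_eq; [exact hq | apply Cmod_ge_0]. }
  apply is_lim_seq_incr_1, is_lim_seq_spec in hlim.
  generalize (hlim (mkposreal _ hpos)); apply filter_imp; intros n; simpl pos.
  rewrite Rminus_0_r, Rabs_pos_eq by (apply pow_le, Cmod_ge_0).
  intros h. unfold ball_norm.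
  change (Cmod (sum_n (G := C_AbelianMonoid) (Cpow q) n - 1 / (1 - q)) < eps)%R.
  replace (sum_n (G := C_AbelianMonoid) (Cpow q) n - 1 / (1 - q))
    with (- (Cpow q (S n) / (1 - q)))
    by (rewrite sum_n_Cpow by exact hq1; field; exact hq1).
  rewrite Cmod_opp, Cmod_div, Cmod_pow by exact hq1.
  apply Rlt_div_l; [now apply Cmod_gt_0 | exact h].
Qed.

(** * Uniqueness of Taylor coefficients *)

Lemma is_series_Re (a : nat -> C) (l : C) :
  @is_series C_AbsRing C_NormedModule a l -> is_series (fun n => Re (a n)) (Re l).
Proof.
  intros h. unfold is_series.
  apply filterlim_ext with (fun n => fst (sum_n (G := C_AbelianMonoid) a n)).
  { induction x as [|n IH]; [now rewrite !sum_O|].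
    rewrite !sum_Sn, <- IH; reflexivity. }
  eapply filterlim_comp; [exact h|]. destruct l as [x y].
  apply (continuous_fst (U := R_UniformSpace) (V := R_UniformSpace)).
Qed.

Lemma is_series_Im (a : nat -> C) (l : C) :
  @is_series C_AbsRing C_NormedModule a l -> is_series (fun n => Im (a n)) (Im l).
Proof.
  intros h. unfold is_series.
  apply filterlim_ext with (fun n => snd (sum_n (G := C_AbelianMonoid) a n)).
  { induction x as [|n IH]; [now rewrite !sum_O|].
    rewrite !sum_Sn, <- IH; reflexivity. }
  eapply filterlim_comp; [exact h|]. destruct l as [x y].
  apply (continuous_snd (U := R_UniformSpace) (V := R_UniformSpace)).
Qed.

Lemma CSeries_unique (a : nat -> C) (l : C) :
  @is_series C_AbsRing C_NormedModule a l -> CSeries a = l.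
Proof.
  intros h. unfold CSeries.
  apply (iota_unique (V := C_CompleteNormedModule)); [|exact h].
  intros y hy. exact (filterlim_locally_unique _ _ _ hy h).
Qed.

(** The terms of a convergent series tend to 0, which they do not do strictly
    outside the disc of convergence. *)
Lemma CV_radius_pos (a : nat -> R) (x : R) :
  (0 < x)%R -> ex_series (fun n => (a n * x ^ n)%R) -> Rbar_lt 0 (CV_radius a).
Proof.
  intros hx hs. apply Rbar_lt_le_trans with (Finite x); [exact hx|].
  apply Rbar_not_lt_le. intros h.
  apply (CV_disk_outside a x); [now rewrite Rabs_pos_eq by lra|].
  now apply ex_series_lim_0.
Qed.

Lemma power_series_coeff_unique (a b : nat -> R) (f : R -> R) :
  (forall x, (Rabs x < 1)%R -> is_series (fun n => (a n * x ^ n)%R) (f x)) ->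
  (forall x, (Rabs x < 1)%R -> is_series (fun n => (b n * x ^ n)%R) (f x)) ->
  forall n, a n = b n.
Proof.
  intros ha hb n.
  assert (h2 : (Rabs (/ 2) < 1)%R) by (rewrite Rabs_pos_eq; lra).
  apply PSeries_ext_recip.
  - apply (CV_radius_pos a (/ 2)); [lra | exists (f (/ 2)%R); auto].
  - apply (CV_radius_pos b (/ 2)); [lra | exists (f (/ 2)%R); auto].
  - exists (mkposreal 1 Rlt_0_1). intros x hx.
    assert (hx1 : (Rabs x < 1)%R).
    { replace x with (x - 0)%R by ring. exact hx. }
    unfold PSeries.
    rewrite (is_series_unique _ _ (ha x hx1)), (is_series_unique _ _ (hb x hx1)).
    reflexivity.
Qed.

Lemma RtoC_in_disc (x : R) : (Rabs x < 1)%R -> (Cmod (RtoC x) < 1)%R.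
Proof. now rewrite Cmod_R. Qed.

(** Real points of the disc already determine the coefficients: on them the real
    and imaginary parts of the series are real power series, whose coefficients
    are known to be unique. *)
Lemma expansion_unique (a b : nat -> C) (f : unit_disc -> C) :
  is_expansion a f -> is_expansion b f -> forall n, a n = b n.
Proof.
  intros ha hb n.
  set (F := fun x : R => match Rlt_dec (Rabs x) 1 with
    | left h => f (exist _ (RtoC x) (RtoC_in_disc x h)) | right _ => 0 end).
  assert (hF : forall c, is_expansion c f -> forall x, (Rabs x < 1)%R ->
    @is_series C_AbsRing C_NormedModule (fun n => c n * RtoC (x ^ n)) (F x)).
  { intros c hc x hx. unfold F. destruct (Rlt_dec (Rabs x) 1) as [h|]; [|easy].
    eapply is_series_ext; [|exact (hc (exist _ (RtoC x) (RtoC_in_disc x h)))].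
    intros k; simpl. now rewrite RtoC_pow. }
  assert (hre : forall c, is_expansion c f -> forall x, (Rabs x < 1)%R ->
    is_series (fun n => (Re (c n) * x ^ n)%R) (Re (F x))).
  { intros c hc x hx. eapply is_series_ext; [|exact (is_series_Re _ _ (hF c hc x hx))].
    intros k; unfold Re; simpl; ring. }
  assert (him : forall c, is_expansion c f -> forall x, (Rabs x < 1)%R ->
    is_series (fun n => (Im (c n) * x ^ n)%R) (Im (F x))).
  { intros c hc x hx. eapply is_series_ext; [|exact (is_series_Im _ _ (hF c hc x hx))].
    intros k; unfold Im; simpl; ring. }
  apply injective_projections.
  - exact (power_series_coeff_unique (fun k => Re (a k)) (fun k => Re (b k)) _
             (hre a ha) (hre b hb) n).
  - exact (power_series_coeff_unique (fun k => Im (a k)) (fun k => Im (b k)) _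
             (him a ha) (him b hb) n).
Qed.

(** Since expansions are unique, the coefficients picked by [epsilon] can be
    computed from any expansion at hand. *)
Lemma coef_unique (a : nat -> C) (f : unit_disc -> C) :
  is_expansion a f -> forall n, coef f n = a n.
Proof.
  intros h. apply (expansion_unique _ _ f); [|exact h].
  exact (epsilon_spec (inhabits (fun _ => RtoC 0)) (fun a => is_expansion a f)
           (ex_intro _ a h)).
Qed.

(** * Inner products of functions with one simple pole *)

Lemma expansion_simple_pole (c p : C) (f : unit_disc -> C) :
  (Cmod p <= 1)%R -> (forall z : unit_disc, f z = c / (1 - p * z)) ->
  is_expansion (fun n => c * Cpow p n) f.
Proof.
  intros hp hf z.
  assert (hpz : (Cmod (p * z) < 1)%R).
  { rewrite Cmod_mult. destruct z as [z hz]; simpl.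
    pose proof (Cmod_ge_0 p); pose proof (Cmod_ge_0 z); nra. }
  pose proof (one_minus_neq_0 _ hpz) as hne.
  replace (f z) with (scal (V := C_ModuleSpace) c (1 / (1 - p * z))).
  2:{ change (c * (1 / (1 - p * z)) = f z). rewrite hf. now field. }
  eapply is_series_ext.
  2:{ apply (is_series_scal (V := C_NormedModule)).
      exact (is_series_C_geometric _ hpz). }
  intros n. change (c * Cpow (p * z) n = c * Cpow p n * Cpow z n).
  rewrite Cpow_mult_l; ring.
Qed.

(** The kernels, their normalizations and their composites with dilations all
    have the form [c / (1 - p * z)], so this one formula covers both the norm of
    a kernel and the Berezin transform.  The terms of the series are
    [c * conj d * (p * conj q / beta)^n]; the bound on [|p| * |q|] makes it
    converge. *)
Lemma H2_inner_simple_poles (beta : R) (c p d q : C) (f g : unit_disc -> C) :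
  (0 < beta)%R -> (Cmod p <= 1)%R -> (Cmod q <= 1)%R -> (Cmod p * Cmod q < beta)%R ->
  (forall z : unit_disc, f z = c / (1 - p * z)) ->
  (forall z : unit_disc, g z = d / (1 - q * z)) ->
  H2_inner beta f g = c * Cconj d / (1 - p * Cconj q / RtoC beta).
Proof.
  intros hb hp hq hpq hf hg. unfold H2_inner. apply CSeries_unique.
  assert (hb0 : RtoC beta <> 0) by (apply RtoC_neq_0; lra).
  set (r := p * Cconj q / RtoC beta).
  assert (hr : (Cmod r < 1)%R).
  { unfold r. rewrite Cmod_div, Cmod_mult, Cmod_conj, Cmod_R, Rabs_pos_eq by (trivial; lra).
    apply Rlt_div_l; lra. }
  pose proof (one_minus_neq_0 _ hr) as hne.
  replace (c * Cconj d / (1 - r))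
    with (scal (V := C_ModuleSpace) (c * Cconj d) (1 / (1 - r))).
  2:{ change (c * Cconj d * (1 / (1 - r)) = c * Cconj d / (1 - r)). now field. }
  eapply is_series_ext.
  2:{ apply (is_series_scal (V := C_NormedModule)).
      exact (is_series_C_geometric _ hr). }
  intros n.
  change (c * Cconj d * Cpow r n
          = coef f n * Cconj (coef g n) * RtoC (weight beta n)).
  rewrite (coef_unique _ _ (expansion_simple_pole c p f hp hf)).
  rewrite (coef_unique _ _ (expansion_simple_pole d q g hq hg)).
  unfold weight, r, Cdiv.
  rewrite Cmult_conj, Cpow_conj, RtoC_pow, RtoC_div, !Cpow_mult_l by lra.
  unfold Cdiv. rewrite Cmult_1_l. ring.
Qed.

(** * The Berezin transform of a dilation *)

Lemma Cmod_RtoC_mult_Cconj (beta : R) (w : C) :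
  (0 < beta)%R -> Cmod (RtoC beta * Cconj w) = (beta * Cmod w)%R.
Proof.
  intros hb. now rewrite Cmod_mult, Cmod_conj, Cmod_R, Rabs_pos_eq by lra.
Qed.

(** This is the ratio of the geometric series for the squared norm of the kernel
    at [w], whose parameter is [p = beta * conj w]. *)
Lemma kernel_parameter_mult_conj (beta : R) (w : C) : (0 < beta)%R ->
  RtoC beta * Cconj w * Cconj (RtoC beta * Cconj w) / RtoC beta
  = RtoC (beta * Cmod w ^ 2).
Proof.
  intros hb. pose proof (RtoC_neq_0 beta ltac:(lra)) as hb0.
  rewrite Cmult_conj, Cconj_conj, RtoC_mult, Cmod2_conj.
  replace (Cconj (RtoC beta)) with (RtoC beta)
    by (apply injective_projections; simpl; ring).
  field; exact hb0.
Qed.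

Lemma scaled_square_bound (beta : R) (w : unit_disc) : (0 < beta)%R ->
  (0 <= beta * Cmod w ^ 2 < beta)%R.
Proof.
  intros hb. destruct w as [w hw]; simpl disc_val.
  pose proof (Cmod_ge_0 w).
  assert (0 <= Cmod w ^ 2 < 1)%R by (simpl; nra). nra.
Qed.

(** The reproducing property at [z = w]: the squared norm of the kernel is its
    value on the diagonal.  Positivity of the norm lets it be cancelled in the
    normalized kernel. *)
Lemma H2_norm_kernel_sqr (beta : R) (w : unit_disc) : (0 < beta <= 1)%R ->
  ((H2_norm beta (kernel beta w)) ^ 2 = / (1 - beta * Cmod w ^ 2))%R
  /\ (0 < H2_norm beta (kernel beta w))%R.
Proof.
  intros hb. pose proof (scaled_square_bound beta w ltac:(lra)) as hs.
  assert (hp : (beta * Cmod w < 1)%R).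
  { destruct w as [w hw]; simpl. pose proof (Cmod_ge_0 w); nra. }
  assert (hinner : H2_inner beta (kernel beta w) (kernel beta w)
                   = RtoC (/ (1 - beta * Cmod w ^ 2))).
  { rewrite (H2_inner_simple_poles beta 1 (RtoC beta * Cconj w)
               1 (RtoC beta * Cconj w) _ _); try (intros z; reflexivity);
      rewrite ?Cmod_RtoC_mult_Cconj by lra; try lra.
    - rewrite kernel_parameter_mult_conj by lra.
      rewrite RtoC_inv, (RtoC_minus 1) by lra.
      replace (Cconj 1) with (RtoC 1) by (apply injective_projections; simpl; ring).
      unfold Cdiv; ring.
    - replace (beta * Cmod w * (beta * Cmod w))%R
        with (beta * (beta * Cmod w ^ 2))%R by ring.
      nra. }
  unfold H2_norm. rewrite hinner, re_RtoC.
  assert (0 < / (1 - beta * Cmod w ^ 2))%R by (apply Rinv_0_lt_compat; lra).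
  split; [apply pow2_sqrt; lra | now apply sqrt_lt_R0].
Qed.

Lemma Cmod_mult_lt_1 (eta : C) (s : R) :
  (Cmod eta <= 1)%R -> (0 <= s < 1)%R -> (Cmod (eta * RtoC s) < 1)%R.
Proof.
  intros he hs. rewrite Cmod_mult, Cmod_R, Rabs_pos_eq by lra.
  pose proof (Cmod_ge_0 eta); nra.
Qed.

Definition linear_fractional_value (eta : C) (s : R) : C :=
  RtoC (1 - s) / (1 - eta * RtoC s).

(** Apply [H2_inner_simple_poles] with parameters [beta * conj w * eta] and
    [beta * conj w] and numerators [1 / N], where [N] is the norm of the kernel.
    The numerators contribute [1 / N^2 = 1 - s] and the ratio of the series is
    [eta * s]. *)
Lemma berezin_transform_dilation (beta : R) (eta : C) (phi : unit_disc -> unit_disc)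
    (w : unit_disc) :
  (0 < beta <= 1)%R -> (Cmod eta <= 1)%R ->
  (forall w : unit_disc, disc_val (phi w) = eta * disc_val w) ->
  berezin_transform beta (composition_operator phi) w
  = linear_fractional_value eta (beta * Cmod w ^ 2).
Proof.
  intros hb he hphi. unfold berezin_transform, linear_fractional_value.
  destruct (H2_norm_kernel_sqr beta w hb) as [hN2 hN].
  pose proof (scaled_square_bound beta w ltac:(lra)) as hs.
  set (N := H2_norm beta (kernel beta w)) in *.
  pose proof (RtoC_neq_0 N ltac:(lra)) as hN0.
  assert (hw : (0 <= beta * Cmod w < 1)%R).
  { destruct w as [w hw]; simpl. pose proof (Cmod_ge_0 w); nra. }
  pose proof (Cmod_ge_0 eta) as he0.
  assert (hsq : (beta * Cmod w * (beta * Cmod w) < beta)%R).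
  { replace (beta * Cmod w * (beta * Cmod w))%R
        with (beta * (beta * Cmod w ^ 2))%R by ring.
    nra. }
  assert (hp : (Cmod (RtoC beta * Cconj w * eta) <= beta * Cmod w)%R).
  { rewrite Cmod_mult, Cmod_RtoC_mult_Cconj by lra. nra. }
  pose proof (Cmod_ge_0 (RtoC beta * Cconj w * eta)) as hp0.
  assert (hpole : forall p z : C, (Cmod p < 1)%R -> (Cmod z < 1)%R ->
    1 / (1 - p * z) / RtoC N = / RtoC N / (1 - p * z)).
  { intros p z hp1 hz. field. split; [exact hN0|].
    apply one_minus_neq_0. rewrite Cmod_mult.
    pose proof (Cmod_ge_0 p); pose proof (Cmod_ge_0 z); nra. }
  rewrite (H2_inner_simple_poles beta (/ RtoC N) (RtoC beta * Cconj w * eta)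
             (/ RtoC N) (RtoC beta * Cconj w)).
  - replace (RtoC beta * Cconj w * eta * Cconj (RtoC beta * Cconj w) / RtoC beta)
      with (eta * RtoC (beta * Cmod w ^ 2))
      by (rewrite <- kernel_parameter_mult_conj by lra; unfold Cdiv; ring).
    f_equal. rewrite <- RtoC_inv by lra.
    replace (Cconj (RtoC (/ N))) with (RtoC (/ N))
      by (apply injective_projections; simpl; ring).
    rewrite <- RtoC_mult. f_equal.
    replace (/ N * / N)%R with (/ N ^ 2)%R by (field; lra).
    rewrite hN2. field; lra.
  - lra.
  - lra.
  - rewrite Cmod_RtoC_mult_Cconj; lra.
  - rewrite (Cmod_RtoC_mult_Cconj beta) by lra. nra.
  - intros z. unfold composition_operator, normalized_kernel, kernel. fold N.
    rewrite hphi.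
    replace (RtoC beta * Cconj w * (eta * z)) with (RtoC beta * Cconj w * eta * z)
      by ring.
    apply hpole; [lra | exact (proj2_sig z)].
  - intros z. unfold normalized_kernel, kernel. fold N.
    apply hpole; [rewrite Cmod_RtoC_mult_Cconj; lra | exact (proj2_sig z)].
Qed.

Lemma berezin_range_dilation (beta : R) (eta : C) (phi : unit_disc -> unit_disc) (c : C) :
  (0 < beta <= 1)%R -> (Cmod eta <= 1)%R ->
  (forall w : unit_disc, disc_val (phi w) = eta * disc_val w) ->
  berezin_range beta (composition_operator phi) c <->
  exists s : R, (0 <= s < beta)%R /\ c = linear_fractional_value eta s.
Proof.
  intros hb he hphi. split.
  - intros [w hw]. exists (beta * Cmod w ^ 2)%R.
    split; [apply scaled_square_bound; lra|].
    rewrite <- hw. now apply berezin_transform_dilation.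
  - intros [s [hs hc]].
    assert (hq : (0 <= s / beta)%R)
      by (apply Rmult_le_pos; [lra | left; apply Rinv_0_lt_compat; lra]).
    assert (hq1 : (s / beta < 1)%R) by (apply Rlt_div_l; lra).
    assert (hr : (Cmod (RtoC (sqrt (s / beta))) < 1)%R).
    { rewrite Cmod_R, Rabs_pos_eq by apply sqrt_pos.
      rewrite <- sqrt_1. apply sqrt_lt_1; lra. }
    (* The radius r with beta * r^2 = s. *)
    exists (exist _ (RtoC (sqrt (s / beta))) hr).
    rewrite (berezin_transform_dilation beta eta phi) by assumption. rewrite hc. f_equal.
    simpl disc_val.
    rewrite Cmod_R, Rabs_pos_eq, pow2_sqrt by (trivial; apply sqrt_pos).
    field; lra.
Qed.

(** * Convexity for real and non-real parameters *)

Lemma linear_fractional_value_real (t s : R) : (1 - t * s <> 0)%R ->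
  linear_fractional_value (RtoC t) s = RtoC ((1 - s) / (1 - t * s)).
Proof.
  intros h. unfold linear_fractional_value.
  now rewrite RtoC_div, (RtoC_minus 1 (t * s)), RtoC_mult by exact h.
Qed.

(** The map [s |-> (1 - s) / (1 - t * s)] is its own inverse, so [y] is attained
    exactly at [s = (1 - y) / (1 - t * y)].  Where [1 - t * y > 0], the conditions
    [0 <= s] and [s < beta] become affine in [y] once the denominator is cleared.
    The second affine inequality already forces [y > 0], and with [y <= 1] and
    [t < 1] this makes the denominator positive. *)
Lemma real_range_iff (beta t y : R) :
  (0 < beta <= 1)%R -> (-1 <= t < 1)%R ->
  (exists s, (0 <= s < beta)%R /\ y = ((1 - s) / (1 - t * s))%R) <->
  (y <= 1 /\ 1 - y < beta * (1 - t * y))%R.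
Proof.
  intros hb ht. split.
  - intros [s [hs ->]].
    assert (hd : (0 < 1 - t * s)%R) by nra.
    assert (h1 : (1 - (1 - s) / (1 - t * s) = s * ((1 - t) / (1 - t * s)))%R)
      by (field; lra).
    assert (h2 : (1 - t * ((1 - s) / (1 - t * s)) = (1 - t) / (1 - t * s))%R)
      by (field; lra).
    assert (hpos : (0 < (1 - t) / (1 - t * s))%R) by (apply Rdiv_lt_0_compat; lra).
    rewrite h2. split; nra.
  - intros [hy1 hy].
    assert (hy0 : (0 < y)%R).
    { apply Rnot_le_lt. intros h. assert (0 < 1 - beta * t)%R by nra. nra. }
    assert (hd : (0 < 1 - t * y)%R) by nra.
    exists ((1 - y) / (1 - t * y))%R. split.
    + split; [apply Rmult_le_pos; [lra | left; now apply Rinv_0_lt_compat]|].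
      apply Rlt_div_l; lra.
    + field. split; nra.
Qed.

(** Because [1 - (1 - s) / (1 - eta * s) = (1 - eta) * s / (1 - eta * s)], the
    midpoint condition reads [s / (1 - eta * s) = 2 * s' / (1 - eta * s')] after
    division by [1 - eta]; clearing denominators leaves the stated equation.  The
    [1] below is the value at [0]. *)
Lemma linear_fractional_value_midpoint (eta : C) (s s' : R) :
  eta <> 1 -> 1 - eta * RtoC s <> 0 -> 1 - eta * RtoC s' <> 0 ->
  RtoC (1 - 1 / 2) * 1 + RtoC (1 / 2) * linear_fractional_value eta s
  = linear_fractional_value eta s' ->
  RtoC (s - 2 * s') = - (eta * RtoC (s * s')).
Proof.
  intros he hd hd' h. unfold linear_fractional_value in h.
  rewrite !RtoC_minus, RtoC_div in h by lra.
  rewrite RtoC_minus, !RtoC_mult.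
  assert (he1 : 1 - eta <> 0).
  { intros h1. apply he. now apply eq_sym, Ceq_minus. }
  assert (h2 : RtoC 2 <> 0) by (apply RtoC_neq_0; lra).
  apply Ceq_minus. apply Ceq_minus in h.
  (* The midpoint equation with its denominators cleared still has the factor
     1 - eta. *)
  assert (hk : (1 - eta) * (RtoC s - 2 * RtoC s' - - (eta * (RtoC s * RtoC s'))) = 0).
  { transitivity (- (2 * (1 - eta * RtoC s) * (1 - eta * RtoC s')) *
      ((1 - 1 / 2) * 1 + 1 / 2 * ((1 - RtoC s) / (1 - eta * RtoC s))
       - (1 - RtoC s') / (1 - eta * RtoC s'))).
    - field; auto.
    - rewrite h; ring. }
  replace (RtoC s - 2 * RtoC s' - - (eta * (RtoC s * RtoC s')))
    with (/ (1 - eta) * ((1 - eta) *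
            (RtoC s - 2 * RtoC s' - - (eta * (RtoC s * RtoC s')))))
    by (field; exact he1).
  rewrite hk; ring.
Qed.

Lemma real_parameter_bounds (eta : C) :
  (Cmod eta <= 1)%R -> Im eta = 0%R -> exists t : R, (-1 <= t <= 1)%R /\ eta = RtoC t.
Proof.
  intros he hi. exists (Re eta).
  assert (h : eta = RtoC (Re eta)) by (apply injective_projections; [reflexivity | exact hi]).
  split; [|exact h]. rewrite h, Cmod_R in he. now apply Rabs_le_between.
Qed.

Theorem theorem4p1 (beta : R) (eta : C) (phi : unit_disc -> unit_disc)
    (hbeta : (0 < beta <= 1)%R) (heta : (Cmod eta <= 1)%R)
    (hphi : forall w : unit_disc, disc_val (phi w) = (eta * disc_val w)%C)
    (hC : bounded_operator beta (composition_operator phi)) :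
  convex_set (berezin_range beta (composition_operator phi)) <->
  exists t : R, (-1 <= t <= 1)%R /\ eta = RtoC t.
Proof.
  pose proof (fun c => berezin_range_dilation beta eta phi c hbeta heta hphi) as hrange.
  assert (hden : forall s, (0 <= s < beta)%R -> 1 - eta * RtoC s <> 0).
  { intros s hs. apply one_minus_neq_0, Cmod_mult_lt_1; lra. }
  split.
  - intros hconv. apply real_parameter_bounds; [exact heta|].
    destruct (Req_dec (Im eta) 0) as [hi|hi]; [exact hi | exfalso].
    assert (he1 : eta <> 1) by (intros h; apply hi; now rewrite h).
    assert (hS1 : berezin_range beta (composition_operator phi) 1).
    { apply hrange. exists 0%R. split; [lra|].
      unfold linear_fractional_value. rewrite Rminus_0_r. field. }
    (* Any s strictly between 0 and beta would do in place of beta / 2. *)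
    assert (hS2 : berezin_range beta (composition_operator phi)
                    (linear_fractional_value eta (beta / 2))).
    { apply hrange. exists (beta / 2)%R. split; [lra | reflexivity]. }
    assert (hmid := hconv _ _ (1 / 2)%R hS1 hS2 ltac:(lra)).
    apply hrange in hmid. destruct hmid as [s' [hs' hmid]].
    apply linear_fractional_value_midpoint in hmid;
      [|exact he1 | apply hden; lra | apply hden; lra].
    assert (hre := f_equal Re hmid). assert (him := f_equal Im hmid).
    destruct eta as [x y]; unfold Re, Im in hre, him, hi; simpl in hre, him, hi.
    assert (hy : (y * (beta * s') = 0)%R) by lra.
    apply Rmult_integral in hy. destruct hy as [hy|hy]; [easy|].
    apply Rmult_integral in hy. destruct hy as [hy|hy]; [lra|].
    subst s'. lra.
  - intros [t [ht ->]].
    destruct (Req_dec t 1) as [->|ht1].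
    + assert (h1 : forall c, berezin_range beta (composition_operator phi) c <-> c = 1).
      { intros c. rewrite hrange. split.
        - intros [s [hs ->]]. rewrite linear_fractional_value_real by lra.
          f_equal. field. lra.
        - intros ->. exists 0%R. split; [lra|].
          rewrite linear_fractional_value_real by lra. f_equal. field. }
      intros x y u hx hy hu. apply h1 in hx, hy. apply h1. subst.
      rewrite RtoC_minus. ring.
    + assert (hR : forall c, berezin_range beta (composition_operator phi) c <->
        exists y : R, c = RtoC y /\ (y <= 1 /\ 1 - y < beta * (1 - t * y))%R).
      { intros c. rewrite hrange. split.
        - intros [s [hs ->]]. exists ((1 - s) / (1 - t * s))%R. split.
          + apply linear_fractional_value_real. nra.
          + apply real_range_iff; [lra | lra |]. now exists s.
        - intros [y [-> hy]]. apply real_range_iff in hy; [|lra|lra].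
          destruct hy as [s [hs ->]]. exists s. split; [exact hs|].
          symmetry. apply linear_fractional_value_real. nra. }
      intros a b u ha hb hu. apply hR in ha, hb. apply hR.
      destruct ha as [y1 [-> [h1 h1']]], hb as [y2 [-> [h2 h2']]].
      exists ((1 - u) * y1 + u * y2)%R.
      split; [now rewrite RtoC_plus, !RtoC_mult|].
      split; [nra|].
      (* A convex combination of two strict inequalities; one weight may vanish. *)
      set (A := (beta * (1 - t * y1) - (1 - y1))%R).
      set (B := (beta * (1 - t * y2) - (1 - y2))%R).
      assert (hA : (0 < A)%R) by (unfold A; lra).
      assert (hB : (0 < B)%R) by (unfold B; lra).
      assert (hAB : (0 < (1 - u) * A + u * B)%R) by nra.
      unfold A, B in hAB. lra.
Qed.
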